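(* For each integer $n \geq 1$ let $d_n = \mathrm{lnzd}(n^n)$, and let $P = 0.d_1d_2d_3\dots d_n\dots = \sum_{n=1}^{\infty} d_n 10^{-n}$ be the real number whose $n$-th decimal digit after the decimal point is $d_n$. Then $P$ is irrational.
   Context: For a positive integer $A$, $\mathrm{lnzd}(A)$ denotes the last nonzero digit of $A$ in base $10$; that is, $\mathrm{lnzd}(A) \in \{1,\dots,9\}$ is the remainder of $A/10^i$ modulo $10$, where $10^i$ is the largest power of $10$ dividing $A$. *)

(* Defs.v *)
From mathcomp Require Import all_boot all_order all_algebra.
From mathcomp Require Import boolp classical_sets reals topology normedtype sequences.
Set Implicit Arguments.
Unset Strict Implicit.
Unset Printing Implicit Defensive.
Import Order.TTheory GRing.Theory Num.Theory.
Import numFieldNormedType.Exports.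
Local Open Scope classical_set_scope.
Local Open Scope ring_scope.

(* The largest i such that 10 ^ i divides A. The bound i < A loses nothing
   when A > 0, since 10 ^ i %| A then forces i < 10 ^ i <= A; see dvdn_val10.
   The library's logn is unusable here because it is 0 at nonprime bases. *)
Definition val10 (A : nat) : nat := (\max_(i < A | 10 ^ i %| A) i)%N.

Lemma dvdn_val10 (A i : nat) : (0 < A)%N -> (10 ^ i %| A)%N = (i <= val10 A)%N.
Proof.
move=> A_gt0; apply/idP/idP => [dvdA | le_i].
  have ltiA : (i < A)%N := leq_trans (ltn_expl i (isT : 1 < 10)%N) (dvdn_leq A_gt0 dvdA).
  exact: (@leq_bigmax_cond _ _ (fun j : 'I_A => j : nat) (Ordinal ltiA) dvdA).
apply: dvdn_trans (dvdn_exp2l 10 le_i) _; rewrite /val10.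
apply: (big_ind (fun m => 10 ^ m %| A)%N) => [|m n mP nP|//].
  by rewrite expn0 dvd1n.
by rewrite /maxn; case: ifP.
Qed.

Definition lnzd (A : nat) : nat := ((A %/ 10 ^ val10 A) %% 10)%N.

Definition lnzd_digit (n : nat) : nat := lnzd (n ^ n)%N.

(* A divergent series would get the default value 0, which is rational;
   irrationality of this number therefore includes convergence. *)
Definition lnzd_number (R : realType) : R :=
  limn (fun N => \sum_(1 <= n < N.+1) (lnzd_digit n)%:R / 10 ^+ n : R).

(* Main.v *)
Require Import Defs.
From mathcomp Require Import all_boot all_order all_algebra cyclic.
From mathcomp Require Import boolp classical_sets reals topology normedtype sequences.
From mathcomp Require Import ring lra zify.
Set Implicit Arguments.
Unset Strict Implicit.
Unset Printing Implicit Defensive.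
Import Order.TTheory GRing.Theory Num.Theory.
Import numFieldNormedType.Exports.

(** The digit sequence of a rational number is eventually periodic, so it
    suffices to see that (d_n) is not.  A period [T] has a multiple of the form
    [n = 10 ^ k * c] with [c] coprime to 10 and [k] as large as we please.  By
    Euler's theorem [c ^ n] ends in 1, because 4 divides [n], so [d_n = 1];
    but [5 * n] is congruent to [n] modulo [T] and [d_(5 * n)] is the last digit
    of [(5 * c) ^ (5 * n)], which is 5. *)

Definition eventually_periodic (A : Type) (d : nat -> A) :=
  exists N T, 0 < T /\ forall n, N <= n -> d (n + T) = d n.

Lemma eventually_periodic_mul (A : Type) (d : nat -> A) N T j n :
  (forall n, N <= n -> d (n + T) = d n) -> N <= n -> d (n + j * T) = d n.
Proof.
move=> dT leNn; elim: j => [|j IHj]; first by rewrite mul0n addn0.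
by rewrite mulSn addnCA addnC dT ?IHj // (leq_trans leNn) ?leq_addr.
Qed.

(* [s n / q] plays the role of the tail [\sum_(i > n) d_i / 10 ^ (i - n)]; it
   lies in ]0, 1], not [0, 1[, because the digits are positive. *)
Lemma division_eventually_periodic (q : nat) (s d : nat -> nat) :
    (forall n, 0 < s n <= q) ->
    (forall n, 10 * s n = q * d n.+1 + s n.+1) ->
  eventually_periodic d.
Proof.
move=> s_bd sE.
have ltsq n : s n < q.+1 by have /andP[] := s_bd n.
pose f (i : 'I_q.+2) := Ordinal (ltsq i).
(* Pigeonhole: [q.+2] indices but only [q.+1] possible values, so some remainder repeats. *)
have /injectivePn[i [j neq_ij [eq_s]]] : ~~ injectiveb f.
  by apply/negP => /injectiveP /leq_card; rewrite !card_ord ltnn.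
wlog lt_ij : i j neq_ij eq_s / i < j.
  move=> wl; have := neq_ij; rewrite -val_eqE /= neq_ltn => /orP[]; first exact: wl.
  by apply: wl; rewrite 1?eq_sym.
(* With remainders in ]0, q], subtracting 1 brings them into [0, q[, so ordinary division by [q]
   recovers the digit. Each remainder thus determines the next digit and the next remainder. *)
have digitE n : d n.+1 = (10 * s n).-1 %/ q.
  have /andP[] := s_bd n.+1; rewrite sE; case: (s n.+1) => // r _ ltrq.
  rewrite addnS /= mulnC divnMDl ?divn_small ?addn0 //.
  exact: leq_trans ltrq.
have step m n : s m = s n -> d m.+1 = d n.+1 /\ s m.+1 = s n.+1.
  move=> eq_mn; have eq_d : d m.+1 = d n.+1 by rewrite !digitE eq_mn.
  by split=> //; have := sE m; rewrite eq_mn sE eq_d => /addnI.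
have eq_sT k : s (i + k) = s (j + k).
  elim: k => [|k IHk]; first by rewrite !addn0.
  by rewrite !addnS; have [] := step _ _ IHk.
exists i.+1, (j - i); split=> [|n lt_in]; first by rewrite subn_gt0.
have -> : n = (i + (n - i.+1)).+1 by lia.
have -> : (i + (n - i.+1)).+1 + (j - i) = (j + (n - i.+1)).+1 by lia.
by have [] := step _ _ (eq_sT (n - i.+1)).
Qed.

Section DecimalExpansion.
Variables (R : realType) (d : nat -> nat).
Hypothesis d_bd : forall n, 0 < d n <= 9.
Local Open Scope ring_scope.

Let S (N : nat) : R := \sum_(1 <= n < N.+1) (d n)%:R / 10 ^+ n.

Let S_S N : S N.+1 = S N + (d N.+1)%:R / 10 ^+ N.+1.
Proof. by rewrite /S big_nat_recr. Qed.

Let S_lt N : S N < S N.+1.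
Proof.
by rewrite S_S ltrDl divr_gt0 ?exprn_gt0 ?ltr0n //; have /andP[] := d_bd N.+1.
Qed.

Let S_nd : nondecreasing_seq S.
Proof. by apply/nondecreasing_seqP => N; apply: ltW. Qed.

(** A digit is at most 9, so the new term together with [10 ^- N.+1] is at most
    [10 * 10 ^- N.+1 = 10 ^- N]. *)
Let S_add_nincr : nonincreasing_seq (fun N => S N + 10 ^- N).
Proof.
apply/nonincreasing_seqP => N; rewrite S_S -addrA lerD2l.
have /andP[_ d9] := d_bd N.+1.
have : (d N.+1)%:R <= 9 :> R by rewrite ler_nat.
have e0 : 0 < 10 ^- N.+1 :> R by rewrite invr_gt0 exprn_gt0.
have -> : 10 ^- N = 10 * 10 ^- N.+1 :> R.
  by rewrite exprS invfM mulrA mulfV ?mul1r ?pnatr_eq0.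
nra.
Qed.

(** As [M] and [N] are independent, this yields both the convergence of [S] and the bound on its
    limit. *)
Let S_le M N : S M <= S N + 10 ^- N.
Proof.
have e0 k : 0 <= 10 ^- k :> R by rewrite invr_ge0 exprn_ge0.
have [leMN|/ltnW leNM] := leqP M N.
  by apply: le_trans (S_nd leMN) _; rewrite lerDl.
by apply: le_trans (S_add_nincr leNM); rewrite lerDl.
Qed.

Let S_cvg : cvgn S.
Proof.
apply: nondecreasing_is_cvgn => //.
by exists (S 0 + 10 ^- 0) => _ [M _ <-]; exact: S_le.
Qed.

(** For a limit [L = a / b], the scaled tails [t N = b * 10 ^ N * (L - S N)] lie in ]0, b]. They are
    integers, since [t 0 = a] and [t N.+1 = 10 * t N - b * d N.+1], so they are remainders of a long
    division by [b]. *)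
Lemma rational_eventually_periodic :
    rational (limn (fun N => \sum_(1 <= n < N.+1) (d n)%:R / 10 ^+ n : R)) ->
  eventually_periodic d.
Proof.
rewrite -/S; set L := limn S => /rationalP[a [b LE]].
have L_gt N : S N < L.
  by apply: lt_le_trans (S_lt N) _; apply: nondecreasing_cvgn_le.
have L_le N : L <= S N + 10 ^- N.
  by apply: limr_le => //; apply: nearW => M; exact: S_le.
have L_gt0 : 0 < L by apply: le_lt_trans (L_gt 0); rewrite /S big_geq.
(* The inverse of 0 is 0, so [b = 0] would make [L] vanish. *)
have b_neq0 : b%:R != 0 :> R.
  by apply: contraTneq L_gt0 => b0; rewrite LE b0 invr0 mulr0 ltxx.
have b_gt0 : 0 < b%:R :> R by rewrite lt_def b_neq0 ler0n.
pose t N : R := b%:R * (10 ^+ N * (L - S N)).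
have tS N : t N.+1 = 10 * t N - b%:R * (d N.+1)%:R.
  rewrite /t S_S exprS; field.
  by rewrite expf_neq0 ?pnatr_eq0.
have t_gt0 N : 0 < t N by rewrite !mulr_gt0 ?subr_gt0 ?exprn_gt0.
have t_le N : t N <= b%:R.
  by rewrite ger_pMr // mulrC -ler_pdivlMr ?exprn_gt0 // mul1r lerBlDl; exact: L_le.
have t_int N : t N \is a Num.int.
  elim: N => [|N IHN]; last by rewrite tS; apply: rpredB; apply: rpredM; rewrite ?natr_int.
  by rewrite /t /S big_geq // subr0 expr0 mul1r LE mulrCA mulfV // mulr1 intr_int.
have /choice[s sE] N : exists k : nat, t N = k%:R.
  by apply/natrP; rewrite natrEint t_int ltW.
apply: (@division_eventually_periodic b s d) => N.
  by rewrite -(ltr0n R) -(ler_nat R) -sE t_gt0 t_le.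
by apply/eqP; rewrite -(eqr_nat R) natrD !natrM -!sE tS addrC subrK.
Qed.

End DecimalExpansion.

Lemma val10_exp_mul k u : 0 < u -> ~~ (10 %| u) -> val10 (10 ^ k * u) = k.
Proof.
move=> u_gt0 ndvd; have A_gt0 : 0 < 10 ^ k * u by rewrite muln_gt0 expn_gt0.
apply/eqP; rewrite eqn_leq -dvdn_val10 // dvdn_mulr // andbT.
by rewrite leqNgt -dvdn_val10 // expnSr dvdn_pmul2l // expn_gt0.
Qed.

Lemma lnzd_exp_mul k u : 0 < u -> ~~ (10 %| u) -> lnzd (10 ^ k * u) = u %% 10.
Proof. by move=> u_gt0 ndvd; rewrite /lnzd val10_exp_mul // mulKn ?expn_gt0. Qed.

Lemma lnzd_bounds A : 0 < A -> 0 < lnzd A <= 9.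
Proof.
move=> A_gt0; rewrite /lnzd -(ltnS _ 9) ltn_pmod // andbT lt0n.
have dvdA : 10 ^ val10 A %| A by rewrite dvdn_val10.
apply/negP => dvd10; have := ltnn (val10 A).
by rewrite -dvdn_val10 // expnS -dvdn_divRL // /dvdn dvd10.
Qed.

Lemma lnzd_digit_bounds n : 0 < lnzd_digit n <= 9.
Proof. by apply: lnzd_bounds; rewrite expn_gt0; case: n. Qed.

(** Here [n ^ n = 10 ^ (k * n) * u ^ n]. Not requiring [u] to be coprime to 10 lets this serve for
    both [c] and [5 * c]. *)
Lemma lnzd_digit_exp_mul k u (n := 10 ^ k * u) :
  ~~ (10 %| u ^ n) -> lnzd_digit n = u ^ n %% 10.
Proof.
move=> ndvd; rewrite /lnzd_digit {1}/n expnMn -expnM lnzd_exp_mul //.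
by rewrite lt0n; apply: contraNneq ndvd => ->.
Qed.

Lemma coprime_exp_mod10 c n : coprime c 10 -> 4 %| n -> c ^ n = 1 %[mod 10].
Proof.
move=> co_c /dvdnP[m ->]; rewrite mulnC expnM -modnXm.
(* The exponent 4 is [totient 10]. *)
by rewrite (Euler_exp_totient co_c) modnXm exp1n.
Qed.

(** An odd multiple of 5 ends in 5, and 5 is idempotent modulo 10. *)
Lemma odd_mul5_exp_mod10 c n : odd c -> 0 < n -> (5 * c) ^ n = 5 %[mod 10].
Proof.
move=> odd_c n_gt0.
have c5 : 5 * c = 5 %[mod 10] by lia.
rewrite -modnXm c5 modnXm; case: n n_gt0 => // n _.
elim: n => // n IHn; by rewrite expnS -modnMmr IHn.
Qed.

Lemma multiple_exp10_coprime T k : 0 < T ->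
  exists j k' c, [/\ j * T = 10 ^ k' * c, k <= k' & coprime c 10].
Proof.
move=> T_gt0.
have [r co2r ->] := @pfactor_coprime 2 T isT T_gt0.
have r_gt0 : 0 < r by rewrite lt0n; apply: contraTneq co2r => ->.
have [c co5c rE] := @pfactor_coprime 5 r isT r_gt0.
set a := logn 2 T; set b := logn 5 r in rE *.
(* As [T = 2 ^ a * 5 ^ b * c], the factor [2 ^ b * 5 ^ a] evens out the two exponents and [10 ^ k]
   makes them large. *)
exists (2 ^ b * 5 ^ a * 10 ^ k), (k + (a + b)), c; split.
- by rewrite rE -[10]/(2 * 5) !expnMn !expnD; ring.
- exact: leq_addr.
- rewrite -[10]/(2 * 5) coprimeMr [coprime c 5]coprime_sym co5c andbT.
  by move: co2r; rewrite rE coprimeMr coprime_sym => /andP[].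
Qed.

Lemma lnzd_digit_not_periodic : ~ eventually_periodic lnzd_digit.
Proof.
case=> N [T [T_gt0 dT]].
(* An exponent of at least [N + 2] ensures both [N <= n] and [4 %| n], the latter through
   [10 ^ 2]. *)
have [j [k [c [jT le_k co_c]]]] := multiple_exp10_coprime (N + 2) T_gt0.
set n := 10 ^ k * c.
have odd_c : odd c.
  by move: co_c; rewrite -[10]/(2 * 5) coprimeMr coprimen2 => /andP[].
have c_gt0 : 0 < c by case: (c) odd_c.
have n_ge : N <= n.
  apply: leq_trans (leq_pmulr _ c_gt0).
  by apply: leq_trans (ltnW (ltn_expl k (isT : 1 < 10))); apply: leq_trans le_k; lia.
have n4 : 4 %| n.
  rewrite dvdn_mulr // (dvdn_trans (isT : 4 %| 10 ^ 2)) // dvdn_exp2l //.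
  by apply: leq_trans le_k; rewrite leq_addl.
have n_gt0 : 0 < n by rewrite muln_gt0 expn_gt0.
have d1 : lnzd_digit n = 1.
  have c1 : c ^ n %% 10 = 1 by rewrite coprime_exp_mod10.
  by rewrite lnzd_digit_exp_mul /dvdn -/n c1.
(* Since [j * T = n], shifting by [4 * j] periods leads from [n] to [5 * n]. *)
have n5 : n + (4 * j) * T = 10 ^ k * (5 * c) by rewrite -mulnA jT /n; ring.
have d5 : lnzd_digit (n + (4 * j) * T) = 5.
  have m_gt0 : 0 < 10 ^ k * (5 * c) by rewrite -n5 addn_gt0 n_gt0.
  have c5 := odd_mul5_exp_mod10 odd_c m_gt0.
  by rewrite n5 lnzd_digit_exp_mul /dvdn c5.
by move: d5; rewrite (eventually_periodic_mul _ dT n_ge) d1.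
Qed.

Theorem theorem2 (R : realType) : irrational (lnzd_number R).
Proof.
move=> /(rational_eventually_periodic lnzd_digit_bounds).
exact: lnzd_digit_not_periodic.
Qed.
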